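(* For each integer $d\ge 2$ there is a positive integer $n_0$ such that if $n\ge n_0$, then $\operatorname{bdim}(1,d;n)=2d$.
   Context: For integers $2\le d<n$, $P(1,d;n)$ is the poset consisting of all $1$-element and all $d$-element subsets of $\{1,\dots,n\}$ ordered by inclusion, and $\operatorname{bdim}(1,d;n)$ is its Boolean dimension. Boolean dimension: for a poset $P$, let $\mathcal{B}=\{L_1,\dots,L_d\}$ be a non-empty family of linear orders on the ground set of $P$ (not necessarily linear extensions) and $\tau:\{0,1\}^d\to\{0,1\}$. For distinct $x,y$, $q(x,y,\mathcal{B})\in\{0,1\}^d$ has $i$-th coordinate $1$ iff $x<y$ in $L_i$. $(\mathcal{B},\tau)$ is a Boolean realizer if for all distinct $x,y$: $x<y$ in $P$ iff $\tau(q(x,y,\mathcal{B}))=1$. $\operatorname{bdim}(P)$ is the least $d$ for which $P$ has a Boolean realizer with $|\mathcal{B}|=d$. *)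

(* Defs.v *)
From HB Require Import structures.
From mathcomp Require Import all_boot all_order.
From mathcomp Require Import boolp.

Set Implicit Arguments.
Unset Strict Implicit.
Unset Printing Implicit Defensive.

Import Order.TTheory.
Local Open Scope order_scope.

Definition linear_order (T : Type) (r : rel T) : Prop :=
  [/\ reflexive r, antisymmetric r, transitive r & total r].

(* The [L i] are non-strict orders, so "x < y in [L i]" is [(x != y) && L i x y]. *)
Definition query (T : eqType) (k : nat) (L : 'I_k -> rel T) (x y : T) :
  k.-tuple bool := [tuple (x != y) && L i x y | i < k].

Definition boolean_realizer (disp : Order.disp_t) (P : porderType disp)
    (k : nat) (L : 'I_k -> rel P) (tau : k.-tuple bool -> bool) : Prop :=
  [/\ (0 < k)%N,
      forall i, linear_order (L i)
    & forall x y : P, x != y -> (x < y) = tau (query L x y)].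

Definition has_boolean_realizer (disp : Order.disp_t) (P : porderType disp)
    (k : nat) : Prop :=
  exists (L : 'I_k -> rel P) (tau : k.-tuple bool -> bool),
    boolean_realizer L tau.

(* Every finite poset has a Boolean realizer: the linear orders that move one
   element to the bottom, or to the top, of a fixed order separate all the
   ordered pairs of distinct elements. *)
Lemma linear_order_preim (T : Type) (f : T -> nat) :
  injective f -> linear_order (fun x y => f x <= f y)%N.
Proof.
move=> f_inj; split.
- by move=> x /=.
- by move=> x y; rewrite -eqn_leq => /eqP /f_inj.
- by move=> y x z; apply: leq_trans.
- by move=> x y; apply: leq_total.
Qed.

Definition moved_rank (T : finType) (o : option (bool * T)) (x : T) : nat :=
  if o is Some (b, a) then
    if x == a then (if b then #|T|.+1 else 0) else (enum_rank x).+1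
  else enum_rank x.

Lemma moved_rank_inj (T : finType) (o : option (bool * T)) :
  injective (moved_rank o).
Proof.
case: o => [[b a]|] x y /=; last by move=> /ord_inj /enum_rank_inj.
have [-> | xa] := eqVneq x a; have [-> | ya] := eqVneq y a => //.
- by case: b => // -[E]; have := ltn_ord (enum_rank y); rewrite -E ltnn.
- by case: b => // -[E]; have := ltn_ord (enum_rank x); rewrite E ltnn.
- by case=> /ord_inj /enum_rank_inj.
Qed.

Lemma moved_rank_sep (T : finType) (x y x' y' : T) : x != y -> x' != y' ->
  (forall o, (moved_rank o x <= moved_rank o y)%N =
             (moved_rank o x' <= moved_rank o y')%N) ->
  x = x' /\ y = y'.
Proof.
move=> xy xy' E.
have bnd (z : T) : ((enum_rank z).+1 < #|T|.+1)%N by rewrite ltnS ltn_ord.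
have xx' : x = x'.
  have := E (Some (true, x)); have := E (Some (false, x)).
  rewrite /= !eqxx [y == x]eq_sym (negbTE xy) leq0n.
  have [-> // | x'x] := eqVneq x' x.
  have [// | y'x] := eqVneq y' x.
  by move=> <-; rewrite ltnNge ltn_ord.
split=> //; rewrite -xx' in xy' E.
have := E (Some (true, y)); have := E (Some (false, y)).
rewrite /= !eqxx (negbTE xy) [y' == y]eq_sym.
have [-> // | yy'] := eqVneq y y'.
by rewrite leqn0 /= => <-; rewrite ltnW ?bnd.
Qed.

Lemma ex_boolean_realizer (disp : Order.disp_t) (P : finPOrderType disp) :
  exists k, `[< has_boolean_realizer P k >].
Proof.
pose I : finType := option (bool * P).
pose L (i : 'I_#|I|) (x y : P) :=
  (moved_rank (enum_val i) x <= moved_rank (enum_val i) y)%N.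
pose tau t := [exists x : P, exists y : P, (x < y) && (t == query L x y)].
exists #|I|; apply/asboolP; exists L, tau; split.
- by apply/card_gt0P; exists None.
- by move=> i; apply/linear_order_preim/moved_rank_inj.
move=> x y xy; apply/idP/existsP => [lt_xy | [x' /existsP[y' /andP[lt' /eqP E]]]].
  by exists x; apply/existsP; exists y; rewrite lt_xy eqxx.
have xy' : x' != y' by rewrite lt_eqF.
have [|-> -> //] := moved_rank_sep xy xy'.
move=> o; have /(congr1 (fun t => tnth t (enum_rank o))) := E.
by rewrite !tnth_mktuple xy xy' /L /= enum_rankK.
Qed.

Definition bdim (disp : Order.disp_t) (P : finPOrderType disp) : nat :=
  ex_minn (ex_boolean_realizer P).

Import Order.DefaultSetSubsetOrder.

(* [{set 'I_n}] is ordered by inclusion; ['I_n] stands for {1, ..., n}. *)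
Definition layers (d n : nat) :=
  {A : {set 'I_n} | (#|A| == 1)%N || (#|A| == d)%N}.

HB.instance Definition _ (d n : nat) := Finite.on (layers d n).
HB.instance Definition _ (d n : nat) := SubType.on (layers d n).
HB.instance Definition _ (d n : nat) :=
  [SubChoice_isSubPOrder of layers d n by <: with Order.SetSubsetOrder.subset_display].

Lemma layers_leE (d n : nat) (A B : layers d n) :
  (A <= B) = (val A \subset val B).
Proof. by []. Qed.

(* Main.v *)
Require Import Defs.
From mathcomp Require Import all_boot all_order.
From mathcomp Require Import boolp zify.

(** Upper bound: fix an enumeration [a_0, ..., a_(d-1)] of every [d]-set [A].
    For each [k] take two orders extending the natural order of the points,
    with [A] just above [a_k] in the first and just below [a_k] in the second.
    A point [x] is [a_k] iff [x < A] in the first and not in the second, and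
    with a common tie-breaking rule this pattern occurs for no other type of
    pair.

    Lower bound: by Ramsey's theorem there are [2d+1] points
    [p_0, ..., p_2d] on which each of the given orders is monotone.  Let
    [A = {p_1, p_3, ...}].  Each order changes its answer to [p_i < A] at most
    once as [i] runs from [0] to [2d], but the truth value of [p_i \in A]
    changes at all of the [2d] steps. *)

Set Implicit Arguments.
Unset Strict Implicit.
Unset Printing Implicit Defensive.

Import Order.TTheory.

(** Induction on [a + b]: [r x], for the head [x], splits the tail in two, and one side keeps at
    least [2 ^ n] entries. Either the list found there already suffices, or [x] can be put in front
    of it. *)
Lemma ramsey_pairwise (T : eqType) (r : rel T) (a b : nat) (s : seq T) :
  2 ^ (a + b) <= size s ->
  exists2 t, subseq t s &
    (size t = a /\ pairwise r t) \/
    (size t = b /\ pairwise (fun x y => ~~ r x y) t).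
Proof.
move En: (a + b) => n; elim: n a b En s => [|n IHn] a b En s.
  by move=> _; exists [::]; [exact: sub0seq | left; split=> //=; lia].
case: a En => [|a] En; first by exists [::]; [exact: sub0seq | left].
case: b En => [|b] En; first by exists [::]; [exact: sub0seq | right].
case: s => [|x s] /=; first by rewrite leqn0 expn_eq0.
rewrite expnS => sz_s.
have cnt := count_predC (r x) s.
have sub (p : pred T) t : subseq t (filter p s) -> subseq t s /\ all p t.
  move=> ts; split; first exact: subseq_trans ts (filter_subseq _ _).
  by apply/allP => y /(mem_subseq ts); rewrite mem_filter => /andP[].
have [leP | ltP] := leqP (2 ^ n) (size (filter (r x) s)).
- have [|t /sub[ts rt] Ht] := IHn a b.+1 _ _ leP; first by lia.
  case: Ht => [[szt pt]|[szt pt]].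
    by exists (x :: t); rewrite /= ?eqxx // szt rt; left.
  by exists t; [exact: subseq_trans ts (subseq_cons _ _) | right].
- have leN : 2 ^ n <= size (filter (predC (r x)) s).
    by rewrite !size_filter in ltP *; lia.
  have [|t /sub[ts rt] Ht] := IHn a.+1 b _ _ leN; first by lia.
  case: Ht => [[szt pt]|[szt pt]].
    by exists t; [exact: subseq_trans ts (subseq_cons _ _) | left].
  by exists (x :: t); rewrite /= ?eqxx // szt rt; right.
Qed.

Lemma subseq_pairwise_many (k m : nat) :
  exists N, forall (T : eqType) (r : nat -> rel T) (s : seq T),
    N <= size s ->
    exists2 t, subseq t s & size t = m /\
      forall j, j < k ->
        pairwise (r j) t \/ pairwise (fun x y => ~~ r j x y) t.
Proof.
elim: k => [|k [N IHk]].
  exists m => T r s sz_s; exists (take m s); first exact: take_subseq.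
  by split=> //; rewrite size_takel.
(* Ramsey with [a = b = N] settles [r k] and leaves [N] entries for the first [k] relations; both
   alternatives pass to subsequences. *)
exists (2 ^ (N + N)) => T r s /(ramsey_pairwise (r k))[t ts Ht].
have [|u ut [szu Hu]] := IHk T r t; first by case: Ht => [[->]|[->]].
exists u; first exact: subseq_trans ut ts.
split=> // j; rewrite ltnS leq_eqVlt => /predU1P[-> | /Hu //].
by case: Ht => -[_ /(subseq_pairwise ut)]; [left | right].
Qed.

(** The earlier of two changes would bring [b] to its extreme value, where monotonicity keeps it. *)
Lemma monotone_change_unique (m : nat) (b : nat -> bool) (i j : nat) :
  (forall u v, u < v <= m -> b u ==> b v) \/
  (forall u v, u < v <= m -> b v ==> b u) ->
  i < m -> j < m -> b i != b i.+1 -> b j != b j.+1 -> i = j.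
Proof.
move=> mono; wlog lt_ij : i j / i < j => [wl | im jm].
  by move=> im jm bi bj; case: (ltngtP i j) => // ij; [|symmetry]; apply: wl.
have [im' jm' ij] :
    [/\ i < i.+1 <= m, j < j.+1 <= m & (i.+1 == j) || (i.+1 < j <= m)].
  by split; lia.
case: mono => mono; move: (mono _ _ im') (mono _ _ jm').
  have : b i.+1 ==> b j.
    by case/orP: ij => [/eqP->|/mono //]; rewrite implybb.
  by case: (b i) (b i.+1) (b j) (b j.+1) => [] [] [] [].
have : b j ==> b i.+1.
  by case/orP: ij => [/eqP->|/mono //]; rewrite implybb.
by case: (b i) (b i.+1) (b j) (b j.+1) => [] [] [] [].
Qed.

Lemma leq_lex_addn (c c' N e e' : nat) : e < N -> e' < N ->
  (c * N + e <= c' * N + e') = (c < c') || (c == c') && (e <= e').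
Proof. by move=> eN eN'; apply/idP/idP; case: (ltngtP c c'); nia. Qed.

Section Layers.
Context {d n : nat}.
Hypothesis d_gt1 : 1 < d.
Implicit Types (x y : layers d n) (k : nat).

Lemma layers_ltE x y : x != y -> (x < y)%O = (val x \subset val y).
Proof. by move=> xy; rewrite lt_def eq_sym xy layers_leE. Qed.

Definition is_point x := #|val x| == 1.

Lemma is_pointPn x : ~~ is_point x -> #|val x| = d.
Proof. by rewrite /is_point; case/orP: (valP x) => [-> // | /eqP]. Qed.

Lemma layers_sub_eq x y :
  is_point x = is_point y -> val x \subset val y -> x = y.
Proof.
move=> xy sub; apply/val_inj/eqP; rewrite eqEcard sub /=.
case: (boolP (is_point x)) (xy) => [/eqP-> /esym/eqP-> //| /is_pointPn->].
by move/esym/negbT/is_pointPn->.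
Qed.

(* [enum (val x)] plays the role of [a_0, a_1, ...]; a point has the same
   coordinate for all [k]. *)
Definition coord k x : nat :=
  nth 0 [seq val i | i <- enum (val x)] (if is_point x then 0 else k).

(* Lexicographic: a [d]-set lies just above its element number [k./2] when [k]
   is odd and just below it when [k] is even; ties are broken by [enum_rank]. *)
Definition layers_rank (k : nat) x : nat :=
  ((coord k./2 x).*2 + (odd k (+) is_point x)) * #|{: layers d n}|
  + enum_rank x.

Lemma layers_rank_inj k : injective (layers_rank k).
Proof.
move=> x y /eqP; rewrite eqn_leq !leq_lex_addn ?ltn_ord // => /andP[H1 H2].
apply/enum_rank_inj/val_inj => /=; move: H1 H2; case: ltngtP => //= _.
by move=> le_xy le_yx; apply/eqP; rewrite eqn_leq le_xy.
Qed.

(** Passing between [k.*2] and [k.*2.+1] only flips the bit added to the doubled coordinate. So the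
    two orders differ only on a point and a [d]-set of equal coordinate, and the odd index puts the
    point first. *)
Lemma layers_rank_pattern k x y :
  (layers_rank k.*2.+1 x <= layers_rank k.*2.+1 y) &&
    ~~ (layers_rank k.*2 x <= layers_rank k.*2 y) =
  [&& is_point x, ~~ is_point y & coord k x == coord k y].
Proof.
rewrite !leq_lex_addn ?ltn_ord //= uphalf_double doubleK odd_double /=.
by case: (is_point x); case: (is_point y) => /=; lia.
Qed.

Lemma coord_eq_sub x y : is_point x -> ~~ is_point y ->
  [exists k : 'I_d, coord k x == coord k y] = (val x \subset val y).
Proof.
move=> xP yP; have /cards1P[i xi] := xP.
have cx k : coord k x = i by rewrite /coord xP xi enum_set1.
have szy : size [seq val j | j <- enum (val y)] = d.
  by rewrite size_map -cardE is_pointPn.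
rewrite xi sub1set -mem_enum -(mem_map val_inj).
apply/existsP/(nthP 0) => [[k] | [k kd ki]].
  by rewrite cx /coord (negbTE yP) => /eqP ki; exists k; rewrite ?szy.
rewrite szy in kd; exists (Ordinal kd).
by rewrite cx /coord (negbTE yP); apply/eqP/esym.
Qed.

Lemma layers_boolean_realizer : has_boolean_realizer (layers d n) (2 * d).
Proof.
pose L (i : 'I_(2 * d)) x y := layers_rank i x <= layers_rank i y.
pose tau (t : (2 * d).-tuple bool) :=
  [exists k : 'I_d, nth false t k.*2.+1 && ~~ nth false t k.*2].
exists L, tau; split; first by lia.
  by move=> i; apply/linear_order_preim/layers_rank_inj.
move=> x y xy; rewrite layers_ltE //.
have q j : j < 2 * d ->
    nth false (query L x y) j = (layers_rank j x <= layers_rank j y).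
  by move=> jd; rewrite -[j]/(val (Ordinal jd)) -tnth_nth tnth_mktuple xy.
transitivity [exists k : 'I_d,
    [&& is_point x, ~~ is_point y & coord k x == coord k y]]; last first.
  apply: eq_existsb => k; rewrite -layers_rank_pattern.
  by have kd := ltn_ord k; rewrite !q //; lia.
(* Apart from a point against a [d]-set, both sides are false: inclusion between equal sizes is
   equality, and a [d]-set does not fit in a point. *)
have [xP | xN] := boolP (is_point x); have [yP | yN] := boolP (is_point y).
- rewrite (introF existsP) => [|[]//].
  by apply/negP => /layers_sub_eq E; rewrite E ?eqxx ?xP in xy.
- by rewrite -coord_eq_sub.
- rewrite (introF existsP) => [|[]//].
  apply/negP => /subset_leq_card; rewrite (is_pointPn xN) (eqP yP); lia.
- rewrite (introF existsP) => [|[]//].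
  apply/negP => /layers_sub_eq E; rewrite E ?eqxx // in xy.
  by rewrite (negbTE xN) (negbTE yN).
Qed.

Lemma point_subproof (i : 'I_n) : (#|[set i]| == 1) || (#|[set i]| == d).
Proof. by rewrite cards1. Qed.

Definition point (i : 'I_n) : layers d n := Sub [set i] (point_subproof i).

(** By transitivity, lying below [x] passes to earlier points if [s] increases in [r], to later ones
    if it decreases; totality turns [~~ ri] into the reversed relation. *)
Lemma monotone_below (r : rel (layers d n)) x (s : seq 'I_n) (i0 : 'I_n) :
  linear_order r ->
  let ri := fun i j => r (point i) (point j) in
  pairwise ri s \/ pairwise (fun i j => ~~ ri i j) s ->
  let b u := r (point (nth i0 s u)) x in
  (forall u v, u < v <= (size s).-1 -> b u ==> b v) \/
  (forall u v, u < v <= (size s).-1 -> b v ==> b u).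
Proof.
move=> [_ _ tr tot] ri mono b.
have bnd u v : u < v <= (size s).-1 -> [/\ u < v, u < size s & v < size s].
  by move=> /andP[]; split; lia.
case: mono => /(pairwiseP i0) mono; [right | left];
  move=> u v /bnd[uv us' vs]; have := mono u v us' vs uv; rewrite /ri => ruv.
  by apply/implyP; apply: tr ruv.
apply/implyP; apply: tr.
by have := tot (point (nth i0 s u)) (point (nth i0 s v)); rewrite (negbTE ruv).
Qed.

Lemma lower_bound_of_monotone (k : nat) (L : 'I_k -> rel (layers d n))
    (tau : k.-tuple bool -> bool) (s : seq 'I_n) :
  boolean_realizer L tau -> uniq s -> size s = (2 * d).+1 ->
  (forall j, let ri := fun u v => L j (point u) (point v) in
     pairwise ri s \/ pairwise (fun u v => ~~ ri u v) s) ->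
  2 * d <= k.
Proof.
move=> [_ lin real] us szs mono.
case: s us szs mono => // i0 s' => us szs mono.
set s := i0 :: s' in us szs mono *.
pose p u := nth i0 s u.
have p_eq u v : u <= 2 * d -> v <= 2 * d -> (p u == p v) = (u == v).
  by move=> ud vd; rewrite nth_uniq ?szs.
pose A := [set p (nat_of_ord u).*2.+1 | u : 'I_d].
have cA : #|A| = d.
  rewrite card_imset ?card_ord // => u v /eqP.
  have := ltn_ord u; have := ltn_ord v => vd ud.
  by rewrite p_eq; [|lia|lia] => /eqP[/double_inj/val_inj].
have Aok : (#|A| == 1) || (#|A| == d) by rewrite cA eqxx orbT.
pose x : layers d n := Sub A Aok.
have pA u : u <= 2 * d -> (p u \in A) = odd u.
  move=> ud; apply/imsetP/idP => [[v _ /eqP] | ou].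
    have := ltn_ord v => vd; rewrite p_eq //; last by lia.
    by move/eqP->; rewrite /= odd_double.
  have u_half : u = (u./2).*2.+1 by rewrite -[LHS]odd_double_half ou.
  have vd : u./2 < d by lia.
  by exists (Ordinal vd); rewrite //= -u_half.
have px u : point (p u) != x.
  by apply/eqP => /(congr1 (fun y => #|val y|)) /=; rewrite cards1 cA; lia.
(* Otherwise both points would have the same query against [x], though exactly one of them lies in
   [A]. *)
have chg (u : 'I_(2 * d)) : exists j,
    L j (point (p u)) x != L j (point (p u.+1)) x.
  have ud := ltn_ord u.
  apply/existsP; rewrite -[X in is_true X]negbK negb_exists; apply/negP.
  move=> /forallP same.
  have := real _ _ (px u); have := real _ _ (px u.+1).
  rewrite !layers_ltE // !sub1set !pA; [|lia|lia].
  suff -> : query L (point (p u)) x = query L (point (p u.+1)) x.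
    by move=> <- /=; case: odd.
  apply: eq_from_tnth => j; rewrite !tnth_mktuple !px /=.
  by apply/eqP; have := same j; rewrite negbK.
have [f fP] := fin_all_exists chg.
(* [f] picks for each step an order that changes there; no order can serve two steps. *)
suff /leq_card : injective f by rewrite !card_ord.
move=> u v uv; apply: val_inj; have := fP v; have := fP u; rewrite -uv.
pose b w := L (f u) (point (p w)) x.
apply: (monotone_change_unique (m := 2 * d) (b := b)) => //.
have := monotone_below x i0 (lin (f u)) (mono (f u)).
by rewrite szs.
Qed.

End Layers.

Theorem theorem2p6 (d : nat) (hd : 2 <= d) :
  exists n0 : nat, 0 < n0 /\
    forall n : nat, n0 <= n -> bdim (layers d n) = 2 * d.
Proof.
have [N Nmono] := subseq_pairwise_many (2 * d) (2 * d).+1.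
exists N.+1; split=> // n ltNn; rewrite /bdim.
case: ex_minnP => k /asboolP[L [tau real]] kmin.
apply/eqP; rewrite eqn_leq kmin /=; last exact/asboolP/layers_boolean_realizer.
case: k L tau real {kmin} => [|k] L tau real; first by case: real.
rewrite leqNgt; apply/negP => ltk.
(* [Nmono] expects relations indexed by naturals; [inord] sends indices beyond [k] to order [0],
   which is merely repeated. *)
pose r j (u v : 'I_n) := L (inord j) (point u) (point v).
have [|s sub [szs mono]] := Nmono _ r (enum 'I_n).
  by rewrite size_enum_ord ltnW.
have us : uniq s := subseq_uniq sub (enum_uniq _).
suff : 2 * d <= k.+1 by lia.
apply: (lower_bound_of_monotone hd real us szs) => j.
have := mono j; rewrite /r inord_val; apply.
by apply: ltn_trans ltk.
Qed.
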